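(* Consider the controlled $N$-particle systems, their infinite-horizon discounted values with discount factor $0\le\delta<1$ and the deterministic limit system described in the context, and assume: (A1) given the context value $C$ and the action $a$ at time $t$, the particles move independently of each other, each according to the Markov kernel $K(a,C)$; (A2) the action set $\mathcal{A}$ is compact; (A3) the maps $(C,a)\mapsto K(a,C)$, $(C,M,a)\mapsto g(C,M,a)$ and $(M,C)\mapsto r(M,C)$ are continuous deterministic functions, uniformly continuous in $a$; (A4) almost surely the initial state $(M^N,C^N)$ converges to a deterministic value $(m,c)$ as $N\to\infty$, and there is $B<\infty$ such that almost surely $\|C^N\|_\infty\le B$ for all $N$; (A6) the reward $r$ and the kernel $K$ do not depend on time; (A7) the reward is bounded: $\sup_{M,C}|r(M,C)|<\infty$. Then $$\lim_{N\to\infty}V^{*N}(M^N,C^N)=v^*(m,c)\quad\text{almost surely},$$ where $v^*$ satisfies the Bellman equation of the deterministic system $$v^*(m,c)=r(m,c)+\delta\sup_{a\in\mathcal{A}}\big\{v^*(\Phi_a(m,c))\big\}.$$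
   Context: Model. Fix $S,d\ge 1$, $\mathcal{S}=\{1,\dots,S\}$, $\mathcal{P}(\mathcal{S})$ the set of probability measures on $\mathcal{S}$ (a subset of $\mathbb{R}^S$), and $\mathcal{P}_N(\mathcal{S})$ the set of $p\in\mathcal{P}(\mathcal{S})$ with $Np(i)\in\mathbb{N}$ for all $i$. The action set $\mathcal{A}$ is a metric space. For $a\in\mathcal{A}$, $C\in\mathbb{R}^d$, $K(a,C)=(K_{i,j}(a,C))_{i,j\in\mathcal{S}}$ is a stochastic matrix; $g:\mathbb{R}^d\times\mathcal{P}(\mathcal{S})\times\mathcal{A}\to\mathbb{R}^d$; and $r:\mathcal{P}(\mathcal{S})\times\mathbb{R}^d\to\mathbb{R}$ is the reward function. None of these depends on $N$. For each $N$ there are $N$ particles with states $X^N_n(t)\in\mathcal{S}$; $(M^N_t)_i=\frac1N\sum_{n=1}^N\mathbf 1_{X^N_n(t)=i}$, so $M^N_t\in\mathcal{P}_N(\mathcal{S})$. If action $a_t$ is used at time $t$, each particle in state $i$ moves to state $j$ with probability $K_{i,j}(a_t,C^N_t)$, and then $C^N_{t+1}=g(C^N_t,M^N_{t+1},a_t)\in\mathbb{R}^d$. The initial states $(M^N_0,C^N_0)=(M^N,C^N)$, $N\ge1$, may be random and are defined on a common probability space; $\|C\|_\infty=\sup_i|C_i|$. Values. A policy $\Pi=(\Pi_0,\Pi_1,\dots)$ is a sequence of (measurable) maps $\Pi_t:\mathcal{P}_N(\mathcal{S})\times\mathbb{R}^d\to\mathcal{A}$; under it the action at time $t$ is $\Pi_t(M^N_t,C^N_t)$.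 For an initial state $(M,C)$ at time $0$, $V^N_\Pi(M,C)=\mathbb{E}_\Pi\big[\sum_{t=0}^\infty\delta^{t}r(M^N_t,C^N_t)\big]$ and $V^{*N}(M,C)=\sup_\Pi V^N_\Pi(M,C)$. Deterministic limit. $\Phi_a(m,c)=(m',c')$ with $m'=mK(a,c)$ and $c'=g(c,m',a)$. The optimal discounted reward $v^*(m,c)$ of the deterministic system is the supremum over action sequences $(a_t)_{t\ge0}$ of $\sum_{t=0}^\infty\delta^t r(m_t,c_t)$, where $(m_0,c_0)=(m,c)$ and $(m_{t+1},c_{t+1})=\Phi_{a_t}(m_t,c_t)$. *)

(* Defs.v *)
From HB Require Import structures.
From mathcomp Require Import all_boot all_order all_algebra.
From mathcomp Require Import all_classical all_reals all_analysis.

Set Implicit Arguments.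
Unset Strict Implicit.
Unset Printing Implicit Defensive.

Import Order.TTheory GRing.Theory Num.Theory.
Import numFieldNormedType.Exports.

Local Open Scope classical_set_scope.
Local Open Scope ring_scope.

Definition prob_vec (R : realType) (S : nat) : set 'rV[R]_S :=
  [set m | (forall i, 0 <= m 0 i) /\ \sum_i m 0 i = 1].

Definition prob_vecN (R : realType) (S N : nat) : set 'rV[R]_S :=
  [set m | prob_vec m /\ forall i, N%:R * m 0 i \is a Num.nat].

Definition stochastic (R : realType) (S : nat) (k : 'M[R]_S) : Prop :=
  (forall i j, 0 <= k i j) /\ forall i, \sum_j k i j = 1.

Definition borel_set (T : topologicalType) : set (set T) :=
  <<s [set U : set T | open U] >>.

Definition borel_fun (T U : topologicalType) (f : T -> U) : Prop :=
  forall B, borel_set B -> borel_set (f @^-1` B).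

Definition borel_rv d (Omega : measurableType d) (U : topologicalType)
    (f : Omega -> U) : Prop :=
  forall B, borel_set B -> measurable (f @^-1` B).

(* The occupancy measure is a point of 'rV_S and the functions below are total
   on it; only their values at probability vectors are ever constrained or
   used. *)
Record model (R : realType) (S d : nat) (A : metricType R) := Model {
  kern : A -> 'rV[R]_d -> 'M[R]_S ;
  dyn : 'rV[R]_d -> 'rV[R]_S -> A -> 'rV[R]_d ;
  reward : 'rV[R]_S * 'rV[R]_d -> R ;
  kern_stochastic : forall a c, stochastic (kern a c)
}.

Definition policy (R : realType) (S d : nat) (A : metricType R) : Type :=
  nat -> 'rV[R]_S * 'rV[R]_d -> A.

(* Since P_N(S) is finite, joint measurability on P_N(S) x R^d amounts to
   measurability of each section at m in P_N(S). *)
Definition admissible (R : realType) (S d : nat) (A : metricType R) (N : nat)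
    (pi : policy S d A) : Prop :=
  forall t m, prob_vecN N m -> borel_fun (fun c => pi t (m, c)).

Definition empirical (R : realType) (S N : nat)
    (x : {ffun 'I_N -> 'I_S}) : 'rV[R]_S :=
  \row_i (N%:R^-1 * \sum_(n < N) (x n == i)%:R).

(* A probability space carrying the N-particle system under the policy pi,
   started at s = (M, C). The law of transition is an elementary conditional
   probability: given the whole past X_0, ..., X_t (which, with the fixed C,
   determines C_0, ..., C_t and the actions), the particles jump independently,
   each according to K(a_t, C_t). *)
Record particle_system (R : realType) (S d : nat) (A : metricType R)
    (mdl : model S d A) (N : nat) (pi : policy S d A)
    (s : 'rV[R]_S * 'rV[R]_d) := ParticleSystem {
  ps_disp : measure_display ;
  ps_space : measurableType ps_disp ;
  ps_prob : probability ps_space R ;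
  ps_X : nat -> ps_space -> {ffun 'I_N -> 'I_S} ;
  ps_C : nat -> ps_space -> 'rV[R]_d ;
  ps_M := fun t w => empirical R (ps_X t w) ;
  ps_act := fun t w => pi t (ps_M t w, ps_C t w) ;
  ps_past := fun t w =>
    [set w' | forall u, (u <= t)%N -> ps_X u w' = ps_X u w] ;
  ps_X_measurable : forall t x, measurable (ps_X t @^-1` [set x]) ;
  ps_init : forall w, (ps_M 0 w, ps_C 0 w) = s ;
  ps_C_step : forall t w,
    ps_C t.+1 w = dyn mdl (ps_C t w) (ps_M t.+1 w) (ps_act t w) ;
  ps_X_step : forall t w y,
    (ps_prob (ps_past t w `&` ps_X t.+1 @^-1` [set y])
     = ps_prob (ps_past t w) *
       (\prod_(n < N) kern mdl (ps_act t w) (ps_C t w)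
                        (ps_X t w n) (y n))%:E)%E
}.

Definition expected_reward (R : realType) (S d : nat) (A : metricType R)
    (mdl : model S d A) (delta : R) (N : nat) (pi : policy S d A)
    (s : 'rV[R]_S * 'rV[R]_d) (ps : particle_system mdl N pi s) : R :=
  fine (expectation (ps_prob ps) (fun w =>
    limn (series (fun t => delta ^+ t * reward mdl (ps_M t w, ps_C t w))))).

(* For N >= 1 and M in P_N(S) realizations exist, and the conditions in
   particle_system determine the law of (M_t, C_t)_t, so all realizations yield
   one and the same number, which xget selects. *)
Definition value (R : realType) (S d : nat) (A : metricType R)
    (mdl : model S d A) (delta : R) (N : nat) (pi : policy S d A)
    (s : 'rV[R]_S * 'rV[R]_d) : R :=
  xget 0 [set v | exists ps : particle_system mdl N pi s,
                    v = expected_reward delta ps].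

Definition opt_value (R : realType) (S d : nat) (A : metricType R)
    (mdl : model S d A) (delta : R) (N : nat)
    (s : 'rV[R]_S * 'rV[R]_d) : R :=
  sup [set value mdl delta N pi s | pi in [set pi | admissible N pi]].

Definition Phi (R : realType) (S d : nat) (A : metricType R)
    (mdl : model S d A) (a : A) (s : 'rV[R]_S * 'rV[R]_d) :
    'rV[R]_S * 'rV[R]_d :=
  let m' := s.1 *m kern mdl a s.2 in (m', dyn mdl s.2 m' a).

Fixpoint det_traj (R : realType) (S d : nat) (A : metricType R)
    (mdl : model S d A) (a : nat -> A) (s : 'rV[R]_S * 'rV[R]_d) (t : nat) :
    'rV[R]_S * 'rV[R]_d :=
  if t is u.+1 then Phi mdl (a u) (det_traj mdl a s u) else s.

Definition det_opt (R : realType) (S d : nat) (A : metricType R)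
    (mdl : model S d A) (delta : R) (s : 'rV[R]_S * 'rV[R]_d) : R :=
  sup [set limn (series (fun t => delta ^+ t * reward mdl (det_traj mdl a s t)))
      | a in [set: nat -> A]].

(* Main.v *)
(** Fix a horizon k: truncating the discounted sums there costs at most
    delta^k B / (1 - delta), so it is enough to compare, for N large and initial
    states close to (m, c), the k-step value J of the particle system (a finite
    recursion on k) with the deterministic one.

    The tool is the weak law of large numbers for one transition: by
    Chebyshev's inequality the next empirical measure is within eta of M K(a, C)
    up to probability S / (N eta^2), uniformly in the state and the action, so
    by continuity the next state lies in a given neighbourhood of Phi_a(m, c)
    with probability close to 1 as soon as (M, C) is close to (m, c).  By
    induction on k:
    - for every policy, J <= v* + delta^k D + eps near (m, c) for N large.
      Only the first action matters in the induction step, and compactness of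
      the action set makes the neighbourhood of (m, c) independent of it; the
      Bellman equation of v* absorbs the action;
    - for an open-loop policy (a_t), J >= v_(a_t) - delta^k D - eps near (m, c).

    Finally every realization of the particle system has value within
    delta^k D of an average of J over initial configurations, and a
    realization exists on [0, 1[ with Lebesgue measure: the interval attached
    to a history is cut into consecutive subintervals whose lengths are
    proportional to the transition probabilities. *)

Require Import Defs.
From HB Require Import structures.
From mathcomp Require Import all_boot all_order all_algebra.
From mathcomp Require Import all_classical all_reals all_analysis.
From mathcomp Require Import measurable_realfun ring lra.

Set Implicit Arguments.
Unset Strict Implicit.
Unset Printing Implicit Defensive.

Import Order.TTheory GRing.Theory Num.Theory.
Import numFieldNormedType.Exports.

Local Open Scope classical_set_scope.
Local Open Scope ring_scope.

(** * Discounted series and the deterministic Bellman equation *)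

Section discounted.
Variables (R : realType) (delta : R).
Hypotheses (delta_ge0 : 0 <= delta) (delta_lt1 : delta < 1).

Let dseries (u : nat -> R) := series (fun t => delta ^+ t * u t).

Let normdelta : `|delta| < 1. Proof. by rewrite ger0_norm. Qed.

Lemma is_cvg_discounted (u : nat -> R) (B : R) :
  (forall t, `|u t| <= B) -> cvgn (dseries u).
Proof.
move=> uB; apply: normed_cvg.
apply: (@series_le_cvg _ _ (geometric B delta)) => [n||n|] /=.
- exact: normr_ge0.
- by move=> n; rewrite mulr_ge0 ?exprn_ge0// (le_trans _ (uB 0%N)).
- by rewrite normrM normrX (ger0_norm delta_ge0) mulrC ler_wpM2r ?exprn_ge0.
- exact: is_cvg_geometric_series.
Qed.

Lemma discounted_bound (u : nat -> R) (B : R) :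
  (forall t, `|u t| <= B) -> `|limn (dseries u)| <= B / (1 - delta).
Proof.
move=> uB.
have gc : series (geometric B delta) n @[n --> \oo] --> B * (1 - delta)^-1.
  exact: cvg_geometric_series.
have le n : `|dseries u n| <= series (geometric B delta) n.
  rewrite /dseries /series /=; apply: le_trans (ler_norm_sum _ _ _) _.
  apply: ler_sum => i _.
  by rewrite normrM normrX (ger0_norm delta_ge0) mulrC ler_wpM2r ?exprn_ge0.
have uc := is_cvg_discounted uB.
rewrite -(cvg_lim _ gc)//.
have nc : `|dseries u n| @[n --> \oo] --> `|limn (dseries u)|.
  exact: cvg_norm.
rewrite -(cvg_lim _ nc)//; apply: ler_lim.
- by apply/cvg_ex; eexists; exact: nc.
- exact: is_cvg_geometric_series.
- by near=> n; exact: le.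
Unshelve. all: by end_near. Qed.

Lemma discounted_recl (u : nat -> R) (B : R) : (forall t, `|u t| <= B) ->
  limn (dseries u) = u 0%N + delta * limn (dseries (fun t => u t.+1)).
Proof.
move=> uB.
have sc : cvgn (dseries (fun t => u t.+1)) by exact: is_cvg_discounted.
have -> : limn (dseries u) = limn (fun n => dseries u n.+1).
  apply/esym/cvg_lim => //; rewrite cvg_shiftS.
  exact: is_cvg_discounted uB.
apply/cvg_lim => //.
have -> : (fun n => dseries u n.+1) =
    (fun n => u 0%N + delta * dseries (fun t => u t.+1) n).
  apply/funext => n; rewrite /dseries /series /= big_nat_recl//= expr0 mul1r.
  congr (_ + _); rewrite big_distrr /=; apply: eq_bigr => i _.
  by rewrite exprS mulrA.
by apply: cvgD; [exact: cvg_cst|apply: cvgMl_tmp].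
Qed.

End discounted.

(** * Dynamic programming for the deterministic system *)

Section bellman.
Variables (R : realType) (S d : nat) (A : metricType R).
Variables (mdl : model S d A) (delta B : R).
Hypotheses (delta_ge0 : 0 <= delta) (delta_lt1 : delta < 1).
Hypothesis A_nonempty : [set: A] !=set0.
Hypothesis rewardB : forall s, prob_vec s.1 -> `|reward mdl s| <= B.

Definition det_value (a : nat -> A) s :=
  limn (series (fun t => delta ^+ t * reward mdl (det_traj mdl a s t))).

Lemma prob_vec_Phi a s : prob_vec s.1 -> prob_vec (Phi mdl a s).1.
Proof.
case: (kern_stochastic mdl a s.2) => K0 K1 [s0 s1]; split => [j|] /=.
  by rewrite mxE; apply: sumr_ge0 => i _; rewrite mulr_ge0.
under eq_bigr do rewrite mxE.
rewrite exchange_big /= -s1; apply: eq_bigr => i _.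
by rewrite -mulr_sumr K1 mulr1.
Qed.

Lemma prob_vec_traj a s t : prob_vec s.1 -> prob_vec (det_traj mdl a s t).1.
Proof. by move=> sP; elim: t => //= t; exact: prob_vec_Phi. Qed.

(** [det_traj] recurses on the last action; dynamic programming has to split off the first one. *)
Lemma det_trajS a s t : det_traj mdl a s t.+1 =
  det_traj mdl (fun u => a u.+1) (Phi mdl (a 0%N) s) t.
Proof. by elim: t => //= t ->. Qed.

Lemma det_value_bound a s : prob_vec s.1 ->
  `|det_value a s| <= B / (1 - delta).
Proof.
by move=> sP; apply: discounted_bound => // t; exact/rewardB/prob_vec_traj.
Qed.

Lemma det_value_recl a s : prob_vec s.1 ->
  det_value a s = reward mdl s +
    delta * det_value (fun u => a u.+1) (Phi mdl (a 0%N) s).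
Proof.
move=> sP; rewrite /det_value (discounted_recl _ _ (B := B))//; last first.
  by move=> t; exact/rewardB/prob_vec_traj.
by under eq_fun do rewrite det_trajS.
Qed.

Lemma det_opt_ub a s : prob_vec s.1 -> det_value a s <= det_opt mdl delta s.
Proof.
move=> sP; apply: ub_le_sup; last by exists a.
exists (B / (1 - delta)) => _ [b _ <-].
by rewrite (le_trans (ler_norm _))//; exact: det_value_bound.
Qed.

Lemma det_opt_le s x :
  (forall a, det_value a s <= x) -> det_opt mdl delta s <= x.
Proof.
move=> ax; apply: ge_sup; last by move=> _ [a _ <-]; exact: ax.
by case: A_nonempty => a0 _; exists (det_value (fun=> a0) s), (fun=> a0).
Qed.

Lemma det_opt_bound s : prob_vec s.1 ->
  `|det_opt mdl delta s| <= B / (1 - delta).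
Proof.
move=> sP; rewrite ler_norml; apply/andP; split; last first.
  by apply: det_opt_le => a; rewrite (le_trans (ler_norm _))// det_value_bound.
case: A_nonempty => a0 _; apply: le_trans (det_opt_ub (fun=> a0) sP).
by have := det_value_bound (fun=> a0) sP; rewrite ler_norml => /andP[].
Qed.

Lemma sup_det_opt_ub a s : prob_vec s.1 ->
  det_opt mdl delta (Phi mdl a s) <=
    sup [set det_opt mdl delta (Phi mdl a' s) | a' in [set: A]].
Proof.
move=> sP; apply: ub_le_sup; last by exists a.
exists (B / (1 - delta)) => _ [a' _ <-].
by rewrite (le_trans (ler_norm _))//; exact/det_opt_bound/prob_vec_Phi.
Qed.

(** An action sequence amounts to a first action together with a sequence played from the next
    state, so the supremum can be taken over the two in turn. *)
Lemma det_opt_bellman s : prob_vec s.1 ->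
  det_opt mdl delta s = reward mdl s +
    delta * sup [set det_opt mdl delta (Phi mdl a s) | a in [set: A]].
Proof.
move=> sP; apply/eqP; rewrite eq_le; apply/andP; split.
  apply: det_opt_le => a; rewrite det_value_recl// lerD2l ler_wpM2l//.
  apply: le_trans (sup_det_opt_ub (a 0%N) sP).
  exact/det_opt_ub/prob_vec_Phi.
(* The supremum is bounded after division by [delta]; for [delta = 0] a constant sequence already
   yields the right-hand side. *)
case: A_nonempty => a0 _; move: delta_ge0; rewrite le0r => /orP[/eqP d0|d0].
  apply: le_trans (det_opt_ub (fun=> a0) sP).
  by rewrite det_value_recl// d0 !mul0r.
rewrite -lerBrDl -ler_pdivlMl//; apply: ge_sup; first by eexists; exists a0.
move=> _ [a _ <-]; apply: det_opt_le => b; rewrite ler_pdivlMl// lerBrDl.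
pose ab t := if t is u.+1 then b u else a.
apply: le_trans (det_opt_ub ab sP); rewrite (det_value_recl _ sP).
exact: lexx.
Qed.

(** The half of the Bellman equation by which the upper bound on particle values absorbs an
    arbitrary first action. *)
Lemma det_opt_Phi_le a s : prob_vec s.1 ->
  reward mdl s + delta * det_opt mdl delta (Phi mdl a s) <= det_opt mdl delta s.
Proof.
by move=> sP; rewrite (det_opt_bellman sP) lerD2l ler_wpM2l// sup_det_opt_ub.
Qed.

End bellman.

(** * Law of large numbers for one transition *)

Section concentration.
Variable R : realType.

Lemma prod_measure_total (I J : finType) (q : I -> J -> R) :
  (forall i, \sum_j q i j = 1) ->
  \sum_(y : {ffun I -> J}) \prod_i q i (y i) = 1.
Proof. by move=> q1; rewrite -bigA_distr_bigA big1. Qed.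

(** Under the product measure the centred variables [Z i] are independent, so expanding the square
    leaves only the diagonal, whose terms are at most 1. *)
Lemma prod_measure_variance (I J : finType) (q Z : I -> J -> R) :
  (forall i j, 0 <= q i j) -> (forall i, \sum_j q i j = 1) ->
  (forall i j, `|Z i j| <= 1) -> (forall i, \sum_j q i j * Z i j = 0) ->
  \sum_(y : {ffun I -> J}) (\prod_i q i (y i)) * (\sum_i Z i (y i)) ^+ 2
    <= #|I|%:R.
Proof.
move=> q0 q1 Z1 qZ.
have -> : \sum_(y : {ffun I -> J}) (\prod_i q i (y i)) * (\sum_i Z i (y i)) ^+ 2
  = \sum_n \sum_n' \sum_(y : {ffun I -> J})
      (\prod_i q i (y i)) * (Z n (y n) * Z n' (y n')).
  under eq_bigr do rewrite expr2 big_distrlr /= big_distrr /=.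
  rewrite exchange_big /=; apply: eq_bigr => n _.
  under eq_bigr do rewrite big_distrr /=.
  by rewrite exchange_big.
have offdiag n n' : n != n' -> \sum_(y : {ffun I -> J})
    (\prod_i q i (y i)) * (Z n (y n) * Z n' (y n')) = 0.
  move=> nn'.
  (* Once [Z k (y k)] is a product over all coordinates, the sum over [y] factors coordinate by
     coordinate; the factor at [n] is the mean of [Z n], which is 0. *)
  have pick_factor (y : {ffun I -> J}) k :
      Z k (y k) = \prod_i (if i == k then Z i (y i) else 1).
    by rewrite -big_mkcond big_pred1_eq.
  under eq_bigr => y _ do rewrite (pick_factor y n) (pick_factor y n').
  under eq_bigr do rewrite -!big_split /=.
  rewrite -(bigA_distr_bigA (fun i j => q i j *
    ((if i == n then Z i j else 1) * (if i == n' then Z i j else 1)))) /=.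
  rewrite (bigD1 n)//= eqxx (negPf nn').
  by under eq_bigr do rewrite mulr1; rewrite qZ mul0r.
have diag n : \sum_(y : {ffun I -> J})
    (\prod_i q i (y i)) * (Z n (y n) * Z n (y n)) <= 1.
  rewrite -[leRHS](prod_measure_total q1); apply: ler_sum => y _.
  rewrite ler_piMr ?prodr_ge0// -expr2 -real_normK ?num_real//.
  by rewrite exprn_ile1.
rewrite -sum1_card natr_sum; apply: ler_sum => n _.
rewrite (bigD1 n)//= [X in _ + X]big1 ?addr0 ?diag// => n'.
by rewrite eq_sym => /offdiag.
Qed.

Lemma empirical_mulmx (S N : nat) (x : {ffun 'I_N -> 'I_S}) (K : 'M[R]_S) j :
  (empirical R x *m K) 0 j = N%:R^-1 * \sum_n K (x n) j.
Proof.
rewrite mxE; under eq_bigr do rewrite mxE -mulrA mulr_suml.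
rewrite -mulr_sumr; congr (_ * _); rewrite exchange_big /=.
apply: eq_bigr => n _; rewrite (bigD1 (x n))//= eqxx mul1r big1 ?addr0//.
by move=> i /negPf; rewrite eq_sym => ->; rewrite mul0r.
Qed.

(** Chebyshev's inequality for each of the [S] coordinates, then a union bound. *)
Lemma empirical_concentration (S N : nat) (x : {ffun 'I_N -> 'I_S})
    (K : 'M[R]_S) (eta : R) : stochastic K -> (0 < N)%N -> 0 < eta ->
  \sum_(y : {ffun 'I_N -> 'I_S} |
     ~~ [forall j, `|empirical R y 0 j - (empirical R x *m K) 0 j| < eta])
     \prod_n K (x n) (y n) <= S%:R / (N%:R * eta ^+ 2).
Proof.
case=> K0 K1 N0 eta0.
have N0R : 0 < N%:R :> R by rewrite ltr0n.
have K_le1 i j : K i j <= 1.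
  by rewrite -(K1 i) (bigD1 j)//= lerDl sumr_ge0.
(* [dev y j] is the centred number of particles in state [j]; a deviation [eta] of the empirical
   measure is a deviation [N * eta] of it. *)
pose dev (y : {ffun 'I_N -> 'I_S}) j := \sum_n ((y n == j)%:R - K (x n) j).
have devE y j :
    empirical R y 0 j - (empirical R x *m K) 0 j = N%:R^-1 * dev y j.
  by rewrite empirical_mulmx mxE -mulrBr -sumrB.
have var j : \sum_(y : {ffun 'I_N -> 'I_S})
    (\prod_n K (x n) (y n)) * dev y j ^+ 2 <= N%:R.
  have := @prod_measure_variance _ _ (fun n => K (x n))
    (fun n i => (i == j)%:R - K (x n) j).
  rewrite card_ord; apply => // [n i|n].
    rewrite ler_norml; have := K0 (x n) j; have := K_le1 (x n) j.
    by case: (i == j) => /= ? ?; apply/andP; split; lra.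
  under eq_bigr do rewrite mulrBr; rewrite sumrB -mulr_suml K1 mul1r.
  rewrite (bigD1 j)//= eqxx mulr1 big1 ?addr0 ?subrr// => i /negPf ->.
  by rewrite mulr0.
have -> : S%:R / (N%:R * eta ^+ 2) =
    \sum_(j < S) (N%:R * eta) ^- 2 * N%:R.
  rewrite sumr_const card_ord -mulr_natl exprMn; field.
  by rewrite !lt0r_neq0.
apply: le_trans (_ : \sum_(j < S) (N%:R * eta) ^- 2 *
    \sum_(y : {ffun 'I_N -> 'I_S}) (\prod_n K (x n) (y n)) * dev y j ^+ 2 <= _);
  last first.
  apply: ler_sum => j _; apply: ler_wpM2l => //.
  by rewrite invr_ge0 exprn_ge0// mulr_ge0// ltW.
under [leRHS]eq_bigr do rewrite mulr_sumr.
rewrite exchange_big /= big_mkcond /=; apply: ler_sum => y _.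
have P0 : 0 <= \prod_n K (x n) (y n) by apply: prodr_ge0.
have T0 j : 0 <= (N%:R * eta) ^- 2 * (\prod_n K (x n) (y n) * dev y j ^+ 2).
  apply: mulr_ge0; last by rewrite mulr_ge0// sqr_ge0.
  by rewrite invr_ge0 exprn_ge0// mulr_ge0// ltW.
(* A far configuration has a coordinate [j] where [dev y j] is at least [N * eta] in absolute value,
   and the term of [j] alone then dominates its probability. *)
case: ifPn => [/forallPn[j]|_]; last exact: sumr_ge0.
rewrite -leNgt devE normrM ger0_norm ?invr_ge0 ?ler0n// ler_pdivlMl// => far.
rewrite (bigD1 j)//= ler_wpDr ?sumr_ge0//.
rewrite mulrCA ler_peMr// ler_pdivlMl ?exprn_gt0 ?mulr_gt0// mulr1.
rewrite -[leRHS]real_normK ?num_real// lerXn2r ?nnegrE//.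
by rewrite mulr_ge0 ?ltW.
Qed.

End concentration.

(** * Random transitions stay near the deterministic one *)

Section one_step.
Variables (R : realType) (S d : nat) (A : metricType R) (mdl : model S d A).
Hypothesis kern_cont : continuous (fun p : 'rV[R]_d * A => kern mdl p.2 p.1).
Hypothesis dyn_cont :
  {within [set p : 'rV[R]_d * 'rV[R]_S * A | prob_vec p.1.2],
    continuous (fun p => dyn mdl p.1.1 p.1.2 p.2)}.

Definition jump_prob N a c (x y : {ffun 'I_N -> 'I_S}) : R :=
  \prod_n kern mdl a c (x n) (y n).

Definition jump_state N a c (y : {ffun 'I_N -> 'I_S}) :
    'rV[R]_S * 'rV[R]_d :=
  (empirical R y, dyn mdl c (empirical R y) a).

Lemma jump_prob_ge0 N a c (x y : {ffun 'I_N -> 'I_S}) : 0 <= jump_prob a c x y.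
Proof. by case: (kern_stochastic mdl a c) => k0 _; exact: prodr_ge0. Qed.

Lemma jump_prob_total N a c (x : {ffun 'I_N -> 'I_S}) :
  \sum_y jump_prob a c x y = 1.
Proof.
case: (kern_stochastic mdl a c) => _ k1.
by rewrite (prod_measure_total (q := fun n => kern mdl a c (x n))).
Qed.

Lemma prob_vec_empirical N (y : {ffun 'I_N -> 'I_S}) : (0 < N)%N ->
  prob_vec (empirical R y).
Proof.
move=> N0; split => [i|]; first by rewrite mxE mulr_ge0 ?invr_ge0 ?sumr_ge0.
under eq_bigr do rewrite mxE.
rewrite -mulr_sumr exchange_big /= (eq_bigr (fun=> 1)).
  by rewrite sumr_const card_ord mulVf// pnatr_eq0 -lt0n.
by move=> n _; rewrite (bigD1 (y n))//= eqxx big1 ?addr0// => i /negPf;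
  rewrite eq_sym => ->.
Qed.

(** The action varies jointly with [N] and the state, so the exceptional probability is controlled
    for all actions near [a0] at once; a compactness argument on the action set takes this form as
    input. *)
Lemma jump_concentration (Q : nat -> 'rV[R]_S * 'rV[R]_d -> Prop) s0 a0 eta :
  prob_vec s0.1 -> 0 < eta ->
  (\forall N \near \oo & s \near Phi mdl a0 s0, prob_vec s.1 -> Q N s) ->
  \forall a \near a0 & i \near filter_prod \oo (nbhs s0),
    (0 < i.1)%N /\ forall x : {ffun 'I_i.1 -> 'I_S}, empirical R x = i.2.1 ->
    \sum_(y | ~~ `[< Q i.1 (jump_state a i.2.2 y) >]) jump_prob a i.2.2 x y
      <= eta.
Proof.
move=> s0P eta0 [[/= NQ sQ] [NQoo [[/= mQ cQ] [mQn cQn] mcQ]] NsQ].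
set G := filter_prod (nbhs a0) (filter_prod \oo (nbhs s0)).
set m' := (Phi mdl a0 s0).1.
have G2 : p.2 @[p --> G] --> filter_prod \oo (nbhs s0) by exact: cvg_snd.
have Ga : p.1 @[p --> G] --> a0 by exact: cvg_fst.
have GN : p.2.1 @[p --> G] --> \oo by exact: (cvg_comp _ _ G2 cvg_fst).
have Gs : p.2.2 @[p --> G] --> s0 by exact: (cvg_comp _ _ G2 cvg_snd).
have Gm : p.2.2.1 @[p --> G] --> s0.1 by exact: (cvg_comp _ _ Gs cvg_fst).
have Gc : p.2.2.2 @[p --> G] --> s0.2 by exact: (cvg_comp _ _ Gs cvg_snd).
have GK : kern mdl p.1 p.2.2.2 @[p --> G] --> kern mdl a0 s0.2.
  exact: (cvg_comp _ _ (cvg_pair Gc Ga) (@kern_cont (s0.2, a0))).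
have GmK j : (p.2.2.1 *m kern mdl p.1 p.2.2.2) 0 j @[p --> G] --> m' 0 j.
  rewrite /m' /= mxE; under eq_fun do rewrite mxE.
  apply: cvg_big => [|i _]; first exact: add_continuous.
  apply: cvgM; first exact: (cvg_comp _ _ Gm (@coord_continuous _ _ _ _ _ _)).
  exact: (cvg_comp _ _ GK (@coord_continuous _ _ _ _ _ _)).
have m'P : prob_vec m' by exact: prob_vec_Phi.
(* [dyn] is continuous relative to probability vectors, so $m'$ and the empirical measures plugged
   into it are shown to be such. *)
have /subspace_continuousP/(_ (s0.2, m', a0) m'P) := dyn_cont.
move=> /(_ cQ cQn) [[/= cmV aV] [[[/= cV mV] [cVn mVn] cmVs] aVn] dynV].
(* Half of [e] is spent on the distance from $m'$ to $M K(a,C)$, by continuity, the other half on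
   the random fluctuation, by concentration. *)
have /nbhs_ballP[e /= e0 eV] : nbhs m' (mQ `&` mV) by exact: filterI.
have e20 : 0 < e / 2 by rewrite divr_gt0.
have near_mK : \forall p \near G, forall j,
    `|m' 0 j - (p.2.2.1 *m kern mdl p.1 p.2.2.2) 0 j| < e / 2.
  by apply: filter_forall => j; exact: (cvgr_dist_lt _ _ (GmK j) _ e20).
have near_N : \forall N \near \oo,
    [/\ NQ N, (0 < N)%N & S%:R / (N%:R * (e / 2) ^+ 2) <= eta].
  near=> N; have N0 : (0 < N)%N by near: N; exact: nbhs_infty_gt.
  split => //; first by near: N.
  have NR : 0 < N%:R :> R by rewrite ltr0n.
  rewrite ler_pdivrMr ?mulr_gt0 ?exprn_gt0// mulrCA -ler_pdivrMr; last first.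
    by rewrite mulr_gt0// exprn_gt0.
  by near: N; exact: nbhs_infty_ger.
have near_N' : \forall p \near G, [/\ NQ p.2.1, (0 < p.2.1)%N &
    S%:R / (p.2.1%:R * (e / 2) ^+ 2) <= eta] by exact: GN near_N.
have near_c : \forall p \near G, cV p.2.2.2 by exact: Gc.
have near_a : \forall p \near G, aV p.1 by exact: Ga.
apply: filterS (filterI near_mK (filterI near_N' (filterI near_c near_a))).
move=> [a [N s]] /= [smK [[NQN N0 Neta] [cs aVa]]]; split=> // x xs.
have := empirical_concentration x (kern_stochastic mdl a s.2) N0 e20.
move=> /le_trans/(_ Neta); apply: le_trans.
rewrite big_mkcond [leRHS]big_mkcond /=; apply: ler_sum => y _.
case: ifPn => [notQ|_]; last by case: ifP => // _; exact: jump_prob_ge0.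
case: ifPn => // /negPn/forallP close; exfalso; move: notQ => /asboolP; apply.
have ym' : ball m' e (empirical R y).
  split => // i j; rewrite ord1 /ball /=.
  have := close j; rewrite xs distrC => far_j.
  rewrite [ltRHS]splitr.
  exact: le_lt_trans (ler_distD _ _ _) (ltrD (smK j) far_j).
have [ymQ ymV] := eV _ ym'; have yP := prob_vec_empirical y N0.
apply: (NsQ (N, jump_state a s.2 y)); last exact: yP.
split => //=; apply: mcQ; split => //=.
by apply: (dynV (s.2, empirical R y, a)) => //; split => //; exact: cmVs.
Unshelve. all: by end_near. Qed.

End one_step.

(** * Finite-horizon values *)

Section horizon.
Variables (R : realType) (S d : nat) (A : metricType R).
Variables (mdl : model S d A) (delta B : R).
Hypotheses (delta_ge0 : 0 <= delta) (delta_lt1 : delta < 1).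
Hypothesis A_nonempty : [set: A] !=set0.
Hypothesis A_compact : compact [set: A].
Hypothesis kern_cont : continuous (fun p : 'rV[R]_d * A => kern mdl p.2 p.1).
Hypothesis dyn_cont :
  {within [set p : 'rV[R]_d * 'rV[R]_S * A | prob_vec p.1.2],
    continuous (fun p => dyn mdl p.1.1 p.1.2 p.2)}.
Hypothesis reward_cont :
  {within [set s : 'rV[R]_S * 'rV[R]_d | prob_vec s.1],
    continuous (reward mdl)}.
Hypothesis rewardB : forall s, prob_vec s.1 -> `|reward mdl s| <= B.

(** Backward recursion for the expected discounted reward of the first [k] steps. It runs over
    configurations rather than occupancy measures because their transition law is an explicit
    product. *)
Fixpoint horizon_value N k (pi : policy S d A) (x : {ffun 'I_N -> 'I_S})
    (c : 'rV[R]_d) : R :=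
  if k is l.+1 then
    let a := pi 0%N (empirical R x, c) in
    reward mdl (empirical R x, c) +
    delta * \sum_y jump_prob mdl a c x y *
      horizon_value l (fun t => pi t.+1) y (jump_state mdl a c y).2
  else 0.

Definition open_loop (a : nat -> A) : policy S d A := fun t _ => a t.

(** Bound on every discounted total, so that [delta ^+ k * D] bounds what is earned from time [k]
    on. *)
Let D := B / (1 - delta).

Lemma jump_average_le N a c (x : {ffun 'I_N -> 'I_S})
    (f : {ffun 'I_N -> 'I_S} -> R) (Q : pred {ffun 'I_N -> 'I_S}) (b e : R) :
  0 <= e ->
  (forall y, `|f y| <= b) -> (forall y, Q y -> f y <= e) ->
  \sum_y jump_prob mdl a c x y * f y <=
    e + b * \sum_(y | ~~ Q y) jump_prob mdl a c x y.
Proof.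
move=> e0 fb fe.
have -> : e = \sum_y jump_prob mdl a c x y * e.
  by rewrite -mulr_suml jump_prob_total mul1r.
rewrite mulr_sumr [X in _ + X]big_mkcond -big_split /=; apply: ler_sum => y _.
have p0 := jump_prob_ge0 mdl a c x y.
case: ifPn => [_|/negPn/fe fye]; last by rewrite addr0 ler_wpM2l.
rewrite (mulrC b) -mulrDr ler_wpM2l// (le_trans (ler_norm _))//.
by rewrite (le_trans (fb y))// lerDr.
Qed.

Lemma horizon_bound N k (pi : policy S d A) (x : {ffun 'I_N -> 'I_S}) c :
  (0 < N)%N -> `|horizon_value k pi x c| <= D.
Proof.
move=> N0; have B0 : 0 <= B.
  by apply: le_trans (rewardB (s := (empirical R x, c)) _) => //;
    exact: prob_vec_empirical.
have d1 : 0 < 1 - delta by rewrite subr_gt0.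
have D0 : 0 <= D by rewrite divr_ge0// ltW.
(* [D] is a fixed point of the recursion on bounds, so it does not grow with [k]. *)
have DE : D = B + delta * D by rewrite /D; field; rewrite lt0r_neq0.
elim: k pi x c => [|k IH] pi x c /=; first by rewrite normr0.
apply: le_trans (ler_normD _ _) _; rewrite DE lerD ?rewardB//.
  exact: prob_vec_empirical.
rewrite normrM ger0_norm// ler_wpM2l//; set a := pi _ _.
apply: le_trans (ler_norm_sum _ _ _) _.
rewrite -[leRHS]mul1r -(jump_prob_total mdl a c x) mulr_suml.
apply: ler_sum => y _.
by rewrite normrM ger0_norm ?jump_prob_ge0// ler_wpM2l ?jump_prob_ge0.
Qed.

Lemma reward_near (s0 : 'rV[R]_S * 'rV[R]_d) (e : R) : prob_vec s0.1 -> 0 < e ->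
  \forall s \near s0, prob_vec s.1 -> `|reward mdl s0 - reward mdl s| < e.
Proof.
move=> s0P e0; have /subspace_continuousP/(_ s0 s0P) := reward_cont.
by move=> /cvgr_dist_lt/(_ _ e0).
Qed.

(** The functions averaged below are differences of two values bounded by [D], so exceptional
    configurations of total probability [eta] cost at most [e]. The [+ 1] in the witness keeps the
    denominator positive when [D] is 0. *)
Let small_eta e : 0 < e -> 0 <= D ->
  exists2 eta, 0 < eta & (D + D) * eta <= e.
Proof.
move=> e0 D0; exists (e / (D + D + 1)).
  by rewrite divr_gt0// ltr_wpDl// addr_ge0.
rewrite mulrCA ler_piMr ?(ltW e0)// ler_pdivrMr ?mul1r ?lerDl//.
by rewrite ltr_wpDl// addr_ge0.
Qed.

(** The policy is quantified inside the neighbourhood, so one threshold on [N] serves all policies.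
    One [e / 3] goes to each of the induction hypothesis, the exceptional configurations and the
    replacement of the reward at [s] by that at [s0]. *)
Lemma horizon_value_ub k (s0 : 'rV[R]_S * 'rV[R]_d) (e : R) :
  prob_vec s0.1 -> 0 < e ->
  \forall N \near \oo & s \near s0, forall (pi : policy S d A)
    (x : {ffun 'I_N -> 'I_S}), empirical R x = s.1 ->
    horizon_value k pi x s.2 <= det_opt mdl delta s0 + delta ^+ k * D + e.
Proof.
elim: k s0 e => [|k IH] s0 e s0P e0.
  (* With no step left the value is 0, and $v^*$ is at least [- D]. *)
  apply: filterE => -[N s] pi x _ /=; rewrite expr0 mul1r.
  have := det_opt_bound delta_ge0 delta_lt1 A_nonempty rewardB s0P.
  by rewrite ler_norml -/D => /andP[? _]; lra.
have D0 : 0 <= D.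
  exact: le_trans (det_opt_bound delta_ge0 delta_lt1 A_nonempty rewardB s0P).
have e30 : 0 < e / 3 by rewrite divr_gt0.
have [eta eta0 Deta] := small_eta e30 D0.
(* The first action is a separate variable [a], detached from the policy followed afterwards, so
   that compactness is applied to [a] alone. *)
pose P (i : nat * ('rV[R]_S * 'rV[R]_d)) a :=
  forall (pi : policy S d A) (x : {ffun 'I_i.1 -> 'I_S}),
  empirical R x = i.2.1 ->
  reward mdl s0 + delta * (\sum_y jump_prob mdl a i.2.2 x y *
      horizon_value k pi y (jump_state mdl a i.2.2 y).2)
    <= det_opt mdl delta s0 + delta ^+ k.+1 * D + (e / 3 + e / 3).
have near_a (a0 : A) : [set: A] a0 ->
    \forall a \near a0 & i \near filter_prod \oo (nbhs s0), P i a.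
  move=> _; set L := det_opt mdl delta (Phi mdl a0 s0).
  have PhiP := prob_vec_Phi mdl a0 s0P.
  have LD : `|L| <= D by exact: det_opt_bound.
  pose Q N s := forall (pi : policy S d A) (x : {ffun 'I_N -> 'I_S}),
    empirical R x = s.1 ->
    horizon_value k pi x s.2 <= L + delta ^+ k * D + e / 3.
  have nearQ : \forall N \near \oo & s \near Phi mdl a0 s0,
      prob_vec s.1 -> Q N s.
    by apply: filterS (IH _ _ PhiP e30) => -[N s] ? _.
  have := jump_concentration kern_cont dyn_cont s0P eta0 nearQ.
  apply: filterS => -[a [N s]] /= [N0 conc] pi x /= /conc far.
  pose f (y : {ffun 'I_N -> 'I_S}) :=
    horizon_value k pi y (jump_state mdl a s.2 y).2 - L.
  have fb y : `|f y| <= D + D.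
    by apply: le_trans (ler_normB _ _) _; rewrite lerD// horizon_bound.
  have fQ y :
      `[< Q N (jump_state mdl a s.2 y) >] -> f y <= delta ^+ k * D + e / 3.
    by move=> /asboolP/(_ pi y erefl); rewrite /f lerBlDl addrA.
  have dkD : 0 <= delta ^+ k * D + e / 3.
    by rewrite addr_ge0 ?(ltW e30)// mulr_ge0// exprn_ge0.
  have := jump_average_le a s.2 x dkD fb fQ.
  have -> : \sum_y jump_prob mdl a s.2 x y * f y =
      (\sum_y jump_prob mdl a s.2 x y *
         horizon_value k pi y (jump_state mdl a s.2 y).2) - L.
    under eq_bigr do rewrite mulrBr.
    by rewrite sumrB -mulr_suml jump_prob_total mul1r.
  set E := \sum_y _; set F := \sum_(y | _) _ => le1.
  have le2 : (D + D) * F <= e / 3.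
    by apply: le_trans Deta; rewrite ler_wpM2l// addr_ge0.
  have de : delta * (e / 3 + e / 3) <= e / 3 + e / 3.
    by rewrite ler_piMl ?(ltW delta_lt1)// addr_ge0 ?(ltW e30).
  have le3 : delta * E <= delta * L + delta ^+ k.+1 * D + (e / 3 + e / 3).
    apply: le_trans (_ : delta * (L + delta ^+ k * D + (e / 3 + e / 3)) <= _).
      by rewrite ler_wpM2l//; lra.
    by rewrite exprS; lra.
  have := det_opt_Phi_le delta_ge0 delta_lt1 A_nonempty rewardB a0 s0P.
  by rewrite -/L; lra.
(* Compactness turns the neighbourhoods depending on [a0] into a single one valid for every
   action. *)
have /compact_near_coveringP covA := A_compact.
have near_P : \forall i \near filter_prod \oo (nbhs s0), [set: A] `<=` P i.
  exact: covA near_a.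
have near_r : \forall N \near \oo & s \near s0,
    prob_vec s.1 -> `|reward mdl s0 - reward mdl s| < e / 3.
  exact: (cvg_snd (F := \oo) (reward_near s0P e30)).
have near_N : \forall N \near \oo & s \near s0, (0 < N)%N.
  exact: (cvg_fst (F := \oo) (G := nbhs s0) (nbhs_infty_gt 0)).
have FF : Filter (filter_prod \oo (nbhs s0)) by exact: filter_prod_filter.
have near_all := @filterI _ _ FF _ _ near_P (@filterI _ _ FF _ _ near_r near_N).
move: near_all; apply: (@filterS _ _ FF).
move=> [N s] /= [Pi [rs N0]] pi x xs.
have sP : prob_vec s.1 by rewrite -xs; exact: prob_vec_empirical.
have := Pi (pi 0%N (empirical R x, s.2)) I (fun t => pi t.+1) x xs.
have := rs sP; rewrite xs -surjective_pairing /= ltr_norml => /andP[? _] ?.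
lra.
Qed.

(** Here the neighbourhood may depend on the action sequence, so each induction step meets a single
    action and follows the deterministic trajectory. *)
Lemma horizon_value_lb k (s0 : 'rV[R]_S * 'rV[R]_d) (e : R) (a : nat -> A) :
  prob_vec s0.1 -> 0 < e ->
  \forall N \near \oo & s \near s0, forall (x : {ffun 'I_N -> 'I_S}),
    empirical R x = s.1 ->
    det_value mdl delta a s0 - delta ^+ k * D - e
      <= horizon_value k (open_loop a) x s.2.
Proof.
elim: k s0 e a => [|k IH] s0 e a s0P e0.
  apply: filterE => -[N s] x _ /=; rewrite expr0 mul1r.
  have := det_value_bound delta_ge0 delta_lt1 rewardB a s0P.
  by rewrite ler_norml -/D => /andP[_ ?]; lra.
have D0 : 0 <= D.
  exact: le_trans (det_value_bound delta_ge0 delta_lt1 rewardB a s0P).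
have e30 : 0 < e / 3 by rewrite divr_gt0.
have [eta eta0 Deta] := small_eta e30 D0.
set a0 := a 0%N; pose a' t := a t.+1.
set L := det_value mdl delta a' (Phi mdl a0 s0).
have PhiP := prob_vec_Phi mdl a0 s0P.
have LD : `|L| <= D by exact: det_value_bound.
pose Q N s := forall (x : {ffun 'I_N -> 'I_S}), empirical R x = s.1 ->
  L - delta ^+ k * D - e / 3 <= horizon_value k (open_loop a') x s.2.
have nearQ : \forall N \near \oo & s \near Phi mdl a0 s0,
    prob_vec s.1 -> Q N s.
  by apply: filterS (IH _ _ a' PhiP e30) => -[N s] ? _.
have conc := jump_concentration kern_cont dyn_cont s0P eta0 nearQ.
have FF : Filter (filter_prod \oo (nbhs s0)) by exact: filter_prod_filter.
(* What holds near [a0] holds at [a0]: this specializes the joint limit to the action actually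
   played. *)
have at_a0 : (a0, i) @[i --> filter_prod \oo (nbhs s0)] -->
    filter_prod (nbhs a0) (filter_prod \oo (nbhs s0)).
  move=> V [[U W] /= [a0U FW] UWV]; apply: filterS FW => i Wi.
  by apply: UWV; split => //; exact: nbhs_singleton a0U.
have near_conc := at_a0 _ conc.
have near_r : \forall N \near \oo & s \near s0,
    prob_vec s.1 -> `|reward mdl s0 - reward mdl s| < e / 3.
  exact: (cvg_snd (F := \oo) (reward_near s0P e30)).
have near_all := @filterI _ _ FF _ _ near_conc near_r.
move: near_all; apply: (@filterS _ _ FF).
move=> [N s] /= [[N0 far] rs] x xs.
pose f (y : {ffun 'I_N -> 'I_S}) :=
  L - horizon_value k (open_loop a') y (jump_state mdl a0 s.2 y).2.
have fb y : `|f y| <= D + D.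
  by apply: le_trans (ler_normB _ _) _; rewrite lerD// horizon_bound.
have fQ y :
    `[< Q N (jump_state mdl a0 s.2 y) >] -> f y <= delta ^+ k * D + e / 3.
  by move=> /asboolP/(_ y erefl); rewrite /f; lra.
have dkD : 0 <= delta ^+ k * D + e / 3.
  by rewrite addr_ge0 ?(ltW e30)// mulr_ge0// exprn_ge0.
have := jump_average_le a0 s.2 x dkD fb fQ.
have -> : \sum_y jump_prob mdl a0 s.2 x y * f y =
    L - (\sum_y jump_prob mdl a0 s.2 x y *
       horizon_value k (open_loop a') y (jump_state mdl a0 s.2 y).2).
  under eq_bigr do rewrite mulrBr.
  by rewrite sumrB -mulr_suml jump_prob_total mul1r.
set E := \sum_y _; have := far x xs; set F := \sum_(y | _) _ => Feta le1.
have le2 : (D + D) * F <= e / 3.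
  by apply: le_trans Deta; rewrite ler_wpM2l// addr_ge0.
have de : delta * (e / 3 + e / 3) <= e / 3 + e / 3.
  by rewrite ler_piMl ?(ltW delta_lt1)// addr_ge0 ?(ltW e30).
have le3 : delta * L - delta ^+ k.+1 * D - (e / 3 + e / 3) <= delta * E.
  apply: le_trans (_ : delta * (L - delta ^+ k * D - (e / 3 + e / 3)) <= _).
    by rewrite exprS; lra.
  by rewrite ler_wpM2l//; lra.
have sP : prob_vec s.1 by rewrite -xs; exact: prob_vec_empirical.
have := rs sP; rewrite ltr_norml => /andP[_ ?].
rewrite (det_value_recl delta_ge0 delta_lt1 rewardB a s0P) -/a0 -/L xs.
rewrite -surjective_pairing -/E; lra.
Qed.

End horizon.

(** * Value of a realization *)

(** Since [E] is finite there are finitely many histories up to time [t], and [U] is the union of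
    the past events that it meets. *)
Lemma measurable_determined (disp : measure_display) (T : measurableType disp)
    (E : finType) (X : nat -> T -> E) (t : nat) (U : set T) :
  (forall w, measurable [set w' | forall u, (u <= t)%N -> X u w' = X u w]) ->
  (forall w w', (forall u, (u <= t)%N -> X u w' = X u w) -> U w -> U w') ->
  measurable U.
Proof.
move=> mpast Upast.
pose hist w := [ffun u : 'I_t.+1 => X u w].
have histP w w' : hist w' = hist w -> forall u, (u <= t)%N -> X u w' = X u w.
  move=> /ffunP h u ut.
  by have := h (Ordinal (ut : (u < t.+1)%N)); rewrite !ffunE.
rewrite (_ : U = \bigcup_(h in [set: {ffun 'I_t.+1 -> E}])
    (hist @^-1` [set h] `&` U)); last first.
  by apply/seteqP; split => [w Uw|w [h _ []]//]; exists (hist w).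
apply: fin_bigcup_measurable => [|h _]; first exact: finite_finset.
have [->|/set0P[w [wh Uw]]] := eqVneq (hist @^-1` [set h] `&` U) set0.
  exact: measurable0.
rewrite (_ : _ `&` _ = [set w' | forall u, (u <= t)%N -> X u w' = X u w])//.
apply/seteqP; split => v.
  by move=> [vh _]; apply: histP; rewrite vh wh.
move=> vw; split; last exact: Upast vw Uw.
by rewrite /= -wh; apply/ffunP => u; rewrite !ffunE vw// -ltnS.
Qed.

(** * Integration over the fibres of a finite-valued map *)

Section fibre_integral.
Context (disp : measure_display) (T : measurableType disp) (R : realType)
  (P : probability T R).

Lemma bounded_integrable (D : set T) (f : T -> R) (b : R) :
  measurable D -> measurable_fun setT f -> (forall x, `|f x| <= b) ->
  P.-integrable D (EFin \o f).
Proof.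
move=> mD mf fb; apply: measurable_bounded_integrable => //.
- by rewrite (le_lt_trans (probability_le1 P mD))// ltry.
- exact: measurable_funS mf.
- exists b; split; first exact: num_real.
  by move=> M bM x _; exact: le_trans (fb x) (ltW bM).
Qed.

Lemma Rintegral_fibres (E : finType) (g : T -> E) (D : set T) (f : T -> R)
    (b : R) :
  measurable D -> (forall y, measurable (g @^-1` [set y])) ->
  measurable_fun setT f -> (forall x, `|f x| <= b) ->
  \int[P]_(x in D) f x = \sum_y \int[P]_(x in D `&` g @^-1` [set y]) f x.
Proof.
move=> mD mg mf fb.
have mDg y : measurable (D `&` g @^-1` [set y]) by exact: measurableI.
have DU : D = \big[setU/set0]_(y <- index_enum E) (D `&` g @^-1` [set y]).
  rewrite eqEsubset; split => x.
    by move=> Dx; rewrite (bigD1 (g x))//=; left.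
  by rewrite -bigcup_seq => -[y _ []].
rewrite {1}/Rintegral {1}DU integral_bigsetU_EFin//; first last.
- by rewrite -DU; apply/measurable_EFinP; exact: measurable_funS mf.
- apply/trivIsetP => y z _ _ yz; rewrite -subset0 => x [[_ /= xy] [_ /= xz]].
  by rewrite -xy -xz eqxx in yz.
- exact: index_enum_uniq.
rewrite -sum_fine// => y _; apply: integrable_fin_num => //.
exact: bounded_integrable mf fb.
Qed.

End fibre_integral.

(** * Expected gain of a particle system given its past *)

Section particle_system_value.
Variables (R : realType) (S d : nat) (A : metricType R).
Variables (mdl : model S d A) (delta B : R).
Hypotheses (delta_ge0 : 0 <= delta) (delta_lt1 : delta < 1).
Hypothesis rewardB : forall s, prob_vec s.1 -> `|reward mdl s| <= B.
Variables (N : nat) (pi : policy S d A) (s : 'rV[R]_S * 'rV[R]_d).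
Hypothesis N_gt0 : (0 < N)%N.
Variable ps : particle_system mdl N pi s.

Local Notation E := {ffun 'I_N -> 'I_S}.
Local Notation X := (@ps_X _ _ _ _ _ _ _ _ ps).
Local Notation C := (@ps_C _ _ _ _ _ _ _ _ ps).
Local Notation P := (ps_prob ps).
Local Notation past := (ps_past (p := ps)).
Local Notation T := (ps_space ps).
Let D := B / (1 - delta).

Lemma ps_M0 w : empirical R (X 0%N w) = s.1.
Proof. exact: (congr1 fst (ps_init w)). Qed.

Lemma ps_C0 w : C 0%N w = s.2.
Proof. exact: (congr1 snd (ps_init w)). Qed.

(** The initial context is fixed and each later one is a function of configurations already in the
    past. *)
Lemma ps_C_past t w w' : past t w w' -> C t w' = C t w.
Proof.
elim: t => [|t IH] ww'; first by rewrite !ps_C0.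
have /IH Ct : past t w w' by move=> u ut; apply: ww'; exact: leqW.
rewrite !ps_C_step /ps_act /ps_M Ct.
by rewrite (ww' t.+1)// (ww' t).
Qed.

Lemma ps_past_trans t w w' : past t w w' -> past t w' = past t w.
Proof.
move=> ww'; rewrite eqEsubset; split => v h u ut.
  by rewrite h// ww'.
by rewrite h// ww'.
Qed.

Lemma ps_pastS t w : past t w `&` X t.+1 @^-1` [set X t.+1 w] = past t.+1 w.
Proof.
rewrite eqEsubset; split => v.
  by move=> [h1 h2] u; rewrite leq_eqVlt => /orP[/eqP ->//|]; exact: h1.
by move=> h; split => [u ut|]; apply: h => //; exact: leqW.
Qed.

Lemma measurable_ps_past t w : measurable (past t w).
Proof.
elim: t => [|t IH]; last first.
  by rewrite -ps_pastS; apply: measurableI => //; exact: ps_X_measurable.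
rewrite (_ : past 0 w = X 0%N @^-1` [set X 0%N w]).
  exact: ps_X_measurable.
rewrite eqEsubset; split => v; first by move=> /(_ 0%N erefl).
by move=> h u; rewrite leqn0 => /eqP ->.
Qed.

Lemma measurable_past_determined t (f : T -> R) :
  (forall w w', past t w w' -> f w' = f w) -> measurable_fun setT f.
Proof.
move=> fpast _ V mV; rewrite setTI.
apply: (@measurable_determined _ _ _ X t) => [w|w w' ww'].
  exact: measurable_ps_past.
by rewrite /= (fpast w w').
Qed.

Definition ps_reward t w := reward mdl (empirical R (X t w), C t w).

Lemma ps_reward_past t w w' : past t w w' -> ps_reward t w' = ps_reward t w.
Proof. by move=> ww'; rewrite /ps_reward (ps_C_past ww') ww'. Qed.

Lemma ps_reward_bound t w : `|ps_reward t w| <= B.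
Proof. by apply: rewardB; exact: prob_vec_empirical. Qed.

(** Discounting restarts at time [t], which gives a one-step recursion in [t]. *)
Definition ps_gain t w :=
  limn (series (fun u => delta ^+ u * ps_reward (u + t) w)).

Lemma ps_gain_bound t w : `|ps_gain t w| <= D.
Proof. by apply: discounted_bound => // u; exact: ps_reward_bound. Qed.

Lemma ps_gain_recl t w :
  ps_gain t w = ps_reward t w + delta * ps_gain t.+1 w.
Proof.
rewrite /ps_gain (discounted_recl _ _ (B := B))//; last first.
  by move=> u; exact: ps_reward_bound.
by under eq_fun do rewrite addSnnS.
Qed.

Lemma measurable_ps_gain t : measurable_fun setT (ps_gain t).
Proof.
apply: (@measurable_fun_cvg _ _ _ _
  (fun n w => series (fun u => delta ^+ u * ps_reward (u + t) w) n)).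
  move=> n; apply: (@measurable_past_determined (n + t)) => w w' ww'.
  rewrite /series /= !big_mkord; apply: eq_bigr => i _; congr (_ * _).
  apply: ps_reward_past => u uit; apply: ww'.
  by rewrite (leq_trans uit)// leq_add2r ltnW.
move=> w _; apply: (is_cvg_discounted delta_ge0 delta_lt1 (B := B)) => u.
exact: ps_reward_bound.
Qed.

Definition policy_after t : policy S d A := fun u => pi (u + t)%N.

(** A conditional expectation given the past, multiplied by the probability of that past, so that
    null histories are covered. The induction peels off the present reward, constant on the past
    event, and splits the rest by the next configuration. *)
Lemma ps_gain_horizon k t w :
  `|\int[P]_(v in past t w) ps_gain t v -
    fine (P (past t w)) *
      horizon_value mdl delta k (policy_after t) (X t w) (C t w)|
    <= delta ^+ k * D * fine (P (past t w)).
Proof.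
have p_ge0 U : 0 <= fine (P U) by exact/fine_ge0/measure_ge0.
have gain_int U u : measurable U -> P.-integrable U (EFin \o ps_gain u).
  move=> mU.
  exact: bounded_integrable mU (measurable_ps_gain u) (ps_gain_bound u).
have cst_int U c : measurable U -> P.-integrable U (EFin \o (fun=> c : R)).
  by move=> mU; apply: (bounded_integrable _ mU _ (b := `|c|)).
have D0 : 0 <= D by exact: le_trans (ps_gain_bound 0 w).
elim: k t w => [|k IH] t w; have mp := measurable_ps_past t w.
  rewrite mulr0 subr0 expr0 mul1r -Rintegral_cst//.
  apply: le_trans (le_normr_Rintegral _ _) _ => //; first exact: gain_int.
  apply: le_Rintegral => //; last 2 first.
  - exact: cst_int.
  - by move=> v _; exact: ps_gain_bound.
  by have := gain_int _ t mp; move=> /integrable_norm.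
set p := fine _; set x := X t w; set c := C t w.
set a := policy_after t 0%N (empirical R x, c).
have step y :
    `|\int[P]_(v in past t w `&` X t.+1 @^-1` [set y]) ps_gain t.+1 v -
    p * (jump_prob mdl a c x y *
     horizon_value mdl delta k (policy_after t.+1) y (jump_state mdl a c y).2)|
    <= delta ^+ k * D * (p * jump_prob mdl a c x y).
  have pE : fine (P (past t w `&` X t.+1 @^-1` [set y])) =
      p * jump_prob mdl a c x y.
    by rewrite ps_X_step fineM// ?fin_num_measure.
  rewrite mulrA -pE.
  (* The induction hypothesis needs a sample point [v] carrying the extended history; if there is
     none, every term vanishes. *)
  have [->|/set0P[v [vw vy]]] :=
      eqVneq (past t w `&` X t.+1 @^-1` [set y]) set0.
    by rewrite Rintegral_set0 measure0 /= mul0r mulr0 subr0 normr0.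
  have := IH t.+1 v; rewrite -ps_pastS (ps_past_trans vw) vy.
  by rewrite ps_C_step /ps_act /ps_M vy (ps_C_past vw) (vw t).
have -> : \int[P]_(v in past t w) ps_gain t v =
    ps_reward t w * p + delta * \int[P]_(v in past t w) ps_gain t.+1 v.
  rewrite -RintegralZl//; last exact: gain_int.
  rewrite -Rintegral_cst// -RintegralD//; last 2 first.
  - exact: cst_int.
  - by have := integrableZl mp delta (gain_int _ t.+1 mp).
  apply: eq_Rintegral => v; rewrite inE => vw.
  by rewrite ps_gain_recl (ps_reward_past vw).
rewrite (Rintegral_fibres P mp (ps_X_measurable ps t.+1)
  (measurable_ps_gain t.+1) (ps_gain_bound t.+1)).
rewrite /= -/x -/c -/a.
have -> : (fun u => policy_after t u.+1) = policy_after t.+1.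
  by apply/funext => u; rewrite /policy_after addSnnS.
rewrite /ps_reward -/x -/c mulrDr opprD addrACA (mulrC p) subrr add0r.
rewrite mulrCA -mulrBr normrM ger0_norm// exprS -!mulrA ler_wpM2l//.
rewrite mulr_sumr -sumrB; apply: le_trans (ler_norm_sum _ _ _) _.
apply: le_trans (ler_sum _ (fun y _ => step y)) _.
by rewrite -!mulr_sumr jump_prob_total mulr1 /D !mulrA.
Qed.

Lemma expected_rewardE : expected_reward delta ps = \int[P]_w ps_gain 0 w.
Proof.
rewrite /expected_reward unlock /Rintegral; congr fine.
apply: eq_integral => w _; rewrite /ps_gain.
by under [in RHS]eq_fun do rewrite addn0.
Qed.

(** The initial state prescribes the occupancy measure but not which particle is where; [q] is the
    law of the initial configuration. *)
Lemma expected_reward_horizon k : exists q : E -> R,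
  [/\ forall x, 0 <= q x, \sum_x q x = 1,
      forall x, q x != 0 -> empirical R x = s.1 &
      `|expected_reward delta ps -
        \sum_x q x * horizon_value mdl delta k pi x s.2| <= delta ^+ k * D].
Proof.
pose q x := fine (P (setT `&` X 0%N @^-1` [set x])).
have qE x w : X 0%N w = x -> setT `&` X 0%N @^-1` [set x] = past 0 w.
  move=> wx; rewrite setTI -wx eqEsubset; split => v; last first.
    by move=> /(_ 0%N erefl).
  by move=> h u; rewrite leqn0 => /eqP ->.
have mX x := ps_X_measurable ps 0 x.
have q1 : \sum_x q x = 1.
  have one_bound (w : T) : `|cst 1 w : R| <= 1 by rewrite normr1.
  have := Rintegral_fibres P measurableT mX
    (@measurable_cst _ _ T R setT (1 : R)) one_bound.
  rewrite Rintegral_cst//= mul1r (@probability_setT _ _ _ P) /= => ->.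
  by apply: eq_bigr => x _; rewrite Rintegral_cst ?mul1r//; exact: measurableI.
exists q; split => // [x|x qx|].
- exact/fine_ge0/measure_ge0.
- have [h|/set0P[w [_ wx]]] := eqVneq (setT `&` X 0%N @^-1` [set x]) set0.
    by move: qx; rewrite /q h measure0 eqxx.
  by rewrite -wx ps_M0.
rewrite expected_rewardE.
rewrite (Rintegral_fibres P measurableT mX (measurable_ps_gain 0)
  (ps_gain_bound 0)).
rewrite -sumrB; apply: le_trans (ler_norm_sum _ _ _) _.
rewrite -[leRHS]mulr1 -q1 mulr_sumr; apply: ler_sum => x _.
have [h|/set0P[w [_ wx]]] := eqVneq (setT `&` X 0%N @^-1` [set x]) set0.
  by rewrite /q h measure0 Rintegral_set0 mul0r mulr0 subr0 normr0.
rewrite /q (qE _ _ wx); have := ps_gain_horizon k 0 w.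
have -> : policy_after 0 = pi by apply/funext => u; rewrite /policy_after addn0.
by rewrite wx ps_C0.
Qed.

End particle_system_value.

(** * Existence of a realization *)

Section unit_interval.
Variable R : realType.

Let unit_measurable :
  measurable (`[0%R, 1%R[%classic : set (measurableTypeR R)).
Proof. exact: measurable_itv. Qed.

Definition unit_prob : set (measurableTypeR R) -> \bar R :=
  mrestr lebesgue_measure unit_measurable.

HB.instance Definition _ := Measure.on unit_prob.

Let unit_prob_setT : unit_prob setT = 1%E.
Proof.
by rewrite /unit_prob /mrestr setTI lebesgue_measure_itv/= lte01 oppr0 adde0.
Qed.

HB.instance Definition _ :=
  Measure_isProbability.Build _ _ _ unit_prob unit_prob_setT.

(* Sending the points outside [0, 1[ to 0 makes every point lie in the interval
   attached to its own history, so the whole line realizes only histories of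
   positive probability. *)
Definition clamp (w : R) : R := if (0 <= w < 1)%R then w else 0.

Lemma clamp_unit w : 0 <= clamp w < 1.
Proof. by rewrite /clamp; case: ifP => // _; rewrite lexx ltr01. Qed.

Definition clamped_itv (lo len : R) : set (measurableTypeR R) :=
  [set w | lo <= clamp w < lo + len].

Lemma measurable_clamped_itv lo len : measurable (clamped_itv lo len).
Proof.
(* All points outside [0, 1[ are sent to 0, so they belong together or not at all. *)
rewrite (_ : clamped_itv lo len =
    (`[lo, lo + len[ `&` `[0, 1[) `|`
    (if (lo <= 0 < lo + len)%R then ~` `[0, 1[%classic else set0)).
  apply: measurableU; first by apply: measurableI; exact: measurable_itv.
  by case: ifP => _ //; apply: measurableC; exact: measurable_itv.
apply/seteqP; split => w /=; rewrite /clamped_itv /clamp /= !in_itv /=.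
  case: ifPn => [w01 ->|w01 lo0]; first by left.
  by right; rewrite lo0 /= in_itv /=; apply/negP.
move=> [[? ->]//|]; case: ifP => //= lo0; rewrite in_itv /= => /negP/negPf ->.
exact: lo0.
Qed.

Lemma unit_prob_clamped_itv lo len : 0 <= lo -> 0 <= len -> lo + len <= 1 ->
  unit_prob (clamped_itv lo len) = len%:E.
Proof.
move=> lo0 len0 lolen1; rewrite /unit_prob /mrestr.
rewrite (_ : _ `&` _ = `[lo, lo + len[%classic).
  rewrite lebesgue_measure_itv/= lte_fin ltrDl.
  move: len0; rewrite le_eqVlt => /orP[/eqP <-|->]; first by rewrite ltxx.
  by rewrite -EFinD addrAC subrr add0r.
apply/seteqP; split => w /=; rewrite /clamped_itv /clamp /= !in_itv /=.
  by move=> [+ w01]; rewrite w01.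
move=> /andP[low wlo]; have w01 : 0 <= w < 1.
  by rewrite (le_trans lo0 low) (lt_le_trans wlo lolen1).
by rewrite w01 low wlo.
Qed.

End unit_interval.

(** * Cutting an interval into cells of prescribed lengths *)

Section cells.
Variables (R : realType) (E : finType) (q : E -> R).
Hypothesis q_ge0 : forall y, 0 <= q y.

(** Cumulative distribution along the enumeration of [E], giving the left ends of the cells. The
    index is a plain number so that [#|E|] is allowed and gives the total mass. *)
Definition mass_below i := \sum_(z | (enum_rank z < i)%N) q z.

Lemma mass_belowS y :
  mass_below (enum_rank y).+1 = mass_below (enum_rank y) + q y.
Proof.
rewrite /mass_below (bigD1 y)//= addrC; congr (_ + _); apply: eq_bigl => z.
rewrite ltnS ltn_neqAle andbC; congr (~~ _ && _).
by rewrite -(inj_eq enum_rank_inj) -val_eqE.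
Qed.

Lemma mass_below_mono i j : (i <= j)%N -> mass_below i <= mass_below j.
Proof.
move=> ij; rewrite /mass_below [leLHS]big_mkcond [leRHS]big_mkcond /=.
apply: ler_sum => z _; case: ifP => [/leq_trans/(_ ij) ->//|_].
by case: ifP.
Qed.

Lemma mass_below_ge0 i : 0 <= mass_below i.
Proof. exact: sumr_ge0. Qed.

Lemma mass_below_top y : mass_below (enum_rank y) + q y <= \sum_z q z.
Proof.
rewrite -mass_belowS /mass_below big_mkcond; apply: ler_sum => z _.
by case: ifP.
Qed.

Definition in_cell (lo w : R) y :=
  lo + mass_below (enum_rank y) <= w < lo + mass_below (enum_rank y) + q y.

(** The cell is the one just before the least index [i] with [w < lo + mass_below i]. That index is
    positive because [w] is at least [lo], and at most [#|E|] because the masses stop growing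
    there. *)
Lemma in_cell_cover lo w :
  lo <= w < lo + \sum_z q z -> exists y, in_cell lo w y.
Proof.
move=> /andP[low wlo].
have ex_i : exists i, w < lo + mass_below i.
  exists #|E|; apply: lt_le_trans wlo _; rewrite lerD2l /mass_below.
  by rewrite [leRHS](eq_bigl xpredT)// => z; rewrite ltn_ord.
case: (ex_minnP ex_i) => -[|i] wi imin.
  by move: wi; rewrite /mass_below big_pred0// addr0 ltNge low.
have iE : (i < #|E|)%N.
  rewrite ltnNge; apply/negP => Ei; suff : (i.+1 <= i)%N by rewrite ltnn.
  apply: imin; apply: lt_le_trans wi _; rewrite lerD2l /mass_below.
  rewrite [leLHS]big_mkcond [leRHS]big_mkcond /=.
  apply: ler_sum => z _; case: ifP => _; last by case: ifP.
  by rewrite (leq_trans (ltn_ord _) Ei).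
exists (enum_val (Ordinal iE)); rewrite /in_cell -addrA -mass_belowS.
rewrite enum_valK /= wi andbT leNgt.
by apply/negP => /imin; rewrite /= ltnn.
Qed.

(** The right end of a cell is the left end of the next one, and left ends increase with the
    rank. *)
Lemma in_cell_inj lo w y z : in_cell lo w y -> in_cell lo w z -> y = z.
Proof.
wlog yz : y z / (enum_rank y <= enum_rank z)%N.
  move=> H; case: (leqP (enum_rank y) (enum_rank z)) => [/H//|/ltnW zy] yw zw.
  by apply/esym; exact: H zy zw yw.
move=> /andP[_ wy] /andP[zw _]; apply/enum_rank_inj/val_inj/eqP => /=.
rewrite eqn_leq yz leqNgt; apply/negP => /mass_below_mono.
rewrite mass_belowS -(lerD2l lo) addrA => /le_trans/(_ zw).
by rewrite leNgt wy.
Qed.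

End cells.

(** * The particle system coded on the unit interval *)

Section realization.
Variables (R : realType) (S d : nat) (A : metricType R) (mdl : model S d A).
Variables (N : nat) (pi : policy S d A) (s : 'rV[R]_S * 'rV[R]_d).
Variable x0 : {ffun 'I_N -> 'I_S}.
Hypothesis x0s : empirical R x0 = s.1.

Local Notation E := {ffun 'I_N -> 'I_S}.
Local Notation T := (measurableTypeR R).

(** What the construction remembers of a history: the current configuration and context, and the
    interval of points that realize it. *)
Record coded := Coded
  { coded_X : E; coded_C : 'rV[R]_d; coded_lo : R; coded_len : R }.

Definition coded_act t z := pi t (empirical R (coded_X z), coded_C z).

Definition coded_mass t z y :=
  coded_len z * jump_prob mdl (coded_act t z) (coded_C z) (coded_X z) y.

Definition coded_next t z y :=
  Coded y (dyn mdl (coded_C z) (empirical R y) (coded_act t z))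
    (coded_lo z + mass_below (coded_mass t z) (enum_rank y)) (coded_mass t z y).

(** The default [coded_X z] makes the function total; at points of the interval of a valid [z] some
    cell is found, by [coded_pick_cell]. *)
Definition coded_pick t z w :=
  odflt (coded_X z)
    [pick y | in_cell (coded_mass t z) (coded_lo z) (clamp w) y].

Fixpoint code t (w : T) :=
  if t is u.+1 then coded_next u (code u w) (coded_pick u (code u w) w)
  else Coded x0 s.2 0 1.

Definition coded_itv z : set T := clamped_itv (coded_lo z) (coded_len z).

Lemma coded_mass_ge0 t z y : 0 <= coded_len z -> 0 <= coded_mass t z y.
Proof. by move=> len0; rewrite mulr_ge0// jump_prob_ge0. Qed.

Lemma coded_mass_total t z : \sum_y coded_mass t z y = coded_len z.
Proof. by rewrite -mulr_sumr jump_prob_total mulr1. Qed.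

Definition coded_ok z :=
  [/\ 0 <= coded_lo z, 0 <= coded_len z & coded_lo z + coded_len z <= 1].

Lemma coded_next_ok t z y : coded_ok z -> coded_ok (coded_next t z y).
Proof.
move=> [lo0 len0 le1]; have m0 y' := coded_mass_ge0 t y' len0.
split => /=; [by rewrite addr_ge0// mass_below_ge0|exact: m0|].
rewrite -addrA (le_trans _ le1)// lerD2l -(coded_mass_total t z).
exact: mass_below_top.
Qed.

Lemma code_ok t w : coded_ok (code t w).
Proof.
elim: t => [|t IH] /=; last exact: coded_next_ok.
by split => //=; rewrite add0r.
Qed.

Lemma coded_pick_cell t z w : coded_ok z -> coded_itv z w ->
  in_cell (coded_mass t z) (coded_lo z) (clamp w) (coded_pick t z w).
Proof.
move=> [_ len0 _] zw; rewrite /coded_pick; case: pickP => //= none.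
have [y] : exists y, in_cell (coded_mass t z) (coded_lo z) (clamp w) y.
  apply: in_cell_cover; first by move=> y; exact: coded_mass_ge0.
  by rewrite coded_mass_total.
by rewrite none.
Qed.

Lemma coded_next_sub t z y : coded_ok z ->
  coded_itv (coded_next t z y) `<=` coded_itv z.
Proof.
move=> [_ len0 _] w /= /andP[/= low wlo].
have m0 y' := coded_mass_ge0 t y' len0.
apply/andP; split; first by rewrite (le_trans _ low)// lerDl mass_below_ge0.
rewrite (lt_le_trans wlo)// -addrA lerD2l -(coded_mass_total t z).
exact: mass_below_top.
Qed.

Lemma code_itv t w : coded_itv (code t w) w.
Proof.
elim: t => [|t IH].
  by rewrite /coded_itv/= /clamped_itv/= add0r clamp_unit.
exact: coded_pick_cell (code_ok t w) IH.
Qed.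

Lemma code_past t w w' :
  (forall u, (u <= t)%N -> coded_X (code u w') = coded_X (code u w)) ->
  code t w' = code t w.
Proof.
elim: t => //= t IH ww'; have tt' : code t w' = code t w.
  by apply: IH => u ut; apply: ww'; exact: leqW.
have := ww' t.+1 (leqnn _); rewrite /= tt' => ->.
by [].
Qed.

(** Intervals of longer histories are nested in those of shorter ones, and the cells of one step are
    disjoint. *)
Lemma code_itv_eq t w w' : coded_itv (code t w) w' ->
  forall u, (u <= t)%N -> code u w' = code u w.
Proof.
elim: t => [|t IH] ww' u; first by rewrite leqn0 => /eqP ->.
have okt := code_ok t w.
have ww't := coded_next_sub okt ww'.
rewrite leq_eqVlt => /orP[/eqP ->|]; last by rewrite ltnS => /(IH ww't).
rewrite /= (IH ww't _ (leqnn t)); congr coded_next.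
have [_ len0 _] := okt.
apply: in_cell_inj (coded_pick_cell t okt ww't) _.
  by move=> y; exact: coded_mass_ge0.
exact: ww'.
Qed.

(** Makes past events measurable and turns their probabilities into lengths. *)
Lemma code_pastE t w :
  [set w' | forall u, (u <= t)%N -> coded_X (code u w') = coded_X (code u w)] =
  coded_itv (code t w).
Proof.
apply/seteqP; split => w' /=.
  by move=> /code_past <-; exact: code_itv.
by move=> ww' u ut; rewrite (code_itv_eq ww').
Qed.

Lemma measurable_code t x :
  measurable ((fun w : T => coded_X (code t w)) @^-1` [set x]).
Proof.
apply: (@measurable_determined _ _ _ (fun t w => coded_X (code t w)) t).
  by move=> w; rewrite code_pastE; exact: measurable_clamped_itv.
by move=> w w' ww' /= <-; exact: ww'.
Qed.

(** By construction the cell of [y] takes the fraction [jump_prob] of the length of the interval of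
    the past. *)
Lemma code_step t (w : T) y :
  (unit_prob ([set w' | forall u, (u <= t)%N ->
       coded_X (code u w') = coded_X (code u w)]
     `&` (fun w' : T => coded_X (code t.+1 w')) @^-1` [set y])
   = unit_prob [set w' | forall u, (u <= t)%N ->
       coded_X (code u w') = coded_X (code u w)] *
     (jump_prob mdl (coded_act t (code t w)) (coded_C (code t w))
       (coded_X (code t w)) y)%:E)%E.
Proof.
have okt := code_ok t w; have [lo0 len0 le1] := okt.
have [lo0' len0' le1'] := coded_next_ok t y okt.
rewrite code_pastE (_ : _ `&` _ = coded_itv (coded_next t (code t w) y)).
  by rewrite /coded_itv !unit_prob_clamped_itv//.
apply/seteqP; split => w' /=.
  move=> [ww' <-]; rewrite -(code_itv_eq ww' (leqnn t)).
  exact: (code_itv t.+1 w').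
move=> ww'; have ww't := coded_next_sub okt ww'; split => //.
rewrite (code_itv_eq ww't (leqnn t)).
apply: in_cell_inj (coded_pick_cell t okt ww't) ww'.
by move=> z; exact: coded_mass_ge0.
Qed.

Definition coded_particle_system : particle_system mdl N pi s.
Proof.
refine (@ParticleSystem R S d A mdl N pi s _ T (@unit_prob R)
  (fun t w => coded_X (code t w)) (fun t w => coded_C (code t w)) _ _ _ _).
- exact: measurable_code.
- by move=> w /=; rewrite x0s -surjective_pairing.
- by [].
- exact: code_step.
Defined.

End realization.

(** List each state [i] exactly [N * M 0 i] times; the list has length [N] because the entries of
    [M] sum to 1. *)
Lemma exists_empirical (R : realType) (S N : nat) (M : 'rV[R]_S) : (0 < N)%N ->
  prob_vecN N M -> exists x : {ffun 'I_N -> 'I_S}, empirical R x = M.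
Proof.
move=> N0 [[_ M1] Mnat].
have /choice[k kE] : forall i, exists n : nat, N%:R * M 0 i = n%:R.
  by move=> i; apply/natrP.
pose l := flatten [seq nseq (k i) i | i <- enum 'I_S].
have count_l j : count_mem j l = k j.
  rewrite /l count_flatten -map_comp sumnE big_map big_enum /= (bigD1 j)//=.
  rewrite count_nseq /= eqxx mul1n big1 ?addn0// => i /negPf ij.
  by rewrite count_nseq /= ij.
have size_l : size l == N.
  rewrite size_flatten /shape -map_comp sumnE big_map big_enum /=.
  rewrite -(eqr_nat R) natr_sum.
  under eq_bigr do rewrite size_nseq -kE.
  by rewrite -mulr_sumr M1 mulr1.
exists [ffun n => tnth (Tuple size_l) n]; apply/rowP => j; rewrite mxE.
have -> : \sum_(n < N) ([ffun n => tnth (Tuple size_l) n] n == j)%:R =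
    (k j)%:R :> R.
  under eq_bigr do rewrite ffunE.
  rewrite -natr_sum -count_l -[in RHS]sum1_count; congr _%:R.
  rewrite [RHS]big_mkcond -[l]/(tval (Tuple size_l)) big_tuple.
  by apply: eq_bigr => n _ /=; case: eqP.
by rewrite -kE mulKf// pnatr_eq0 -lt0n.
Qed.

Lemma exists_particle_system (R : realType) (S d : nat) (A : metricType R)
    (mdl : model S d A) (N : nat) (pi : policy S d A)
    (s : 'rV[R]_S * 'rV[R]_d) : (0 < N)%N -> prob_vecN N s.1 ->
  inhabited (particle_system mdl N pi s).
Proof.
move=> N0 /(exists_empirical N0)[x0 x0s].
by split; exact: coded_particle_system x0s.
Qed.

(** * Convergence of the optimal values *)

Lemma admissible_open_loop (R : realType) (S d : nat) (A : metricType R)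
    (N : nat) (a : nat -> A) : admissible N (open_loop (S := S) (d := d) a).
Proof.
move=> t m _ U _; rewrite /open_loop preimage_cst; case: ifP => _.
  by apply: sub_gen_smallest; exact: openT.
by apply: sub_gen_smallest; exact: open0.
Qed.

Lemma prob_vec_lim (R : realType) (S : nat) (M : nat -> 'rV[R]_S)
    (m : 'rV[R]_S) :
  (forall N, (0 < N)%N -> prob_vec (M N)) -> M N @[N --> \oo] --> m ->
  prob_vec m.
Proof.
move=> MP Mm.
(* The shift skips index 0, where [M] is unconstrained. *)
have Mi i : M N.+1 0 i @[N --> \oo] --> m 0 i.
  rewrite (cvg_shiftS (fun N => M N 0 i)).
  exact: (cvg_comp _ _ Mm (@coord_continuous _ _ _ 0 i m)).
split => [i|].
  rewrite -(cvg_lim (@Rhausdorff _) (Mi i)); apply: limr_ge.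
    by apply/cvg_ex; exists (m 0 i); exact: Mi.
  by near=> N; exact: (MP N.+1 erefl).1.
have sM : \sum_i M N.+1 0 i @[N --> \oo] --> \sum_i m 0 i.
  by apply: cvg_big => [|i _]; [exact: add_continuous|exact: Mi].
have : (1 : R) @[N --> \oo] --> \sum_i m 0 i.
  by move: sM; under eq_fun => N do rewrite (MP N.+1 isT).2.
by move=> /(cvg_lim (@Rhausdorff _)) <-; rewrite lim_cst.
Unshelve. all: by end_near. Qed.

Section convergence.
Variables (R : realType) (S d : nat) (A : metricType R).
Variables (mdl : model S d A) (delta B : R).
Hypotheses (delta_ge0 : 0 <= delta) (delta_lt1 : delta < 1).
Hypothesis A_nonempty : [set: A] !=set0.
Hypothesis A_compact : compact [set: A].
Hypothesis kern_cont : continuous (fun p : 'rV[R]_d * A => kern mdl p.2 p.1).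
Hypothesis dyn_cont :
  {within [set p : 'rV[R]_d * 'rV[R]_S * A | prob_vec p.1.2],
    continuous (fun p => dyn mdl p.1.1 p.1.2 p.2)}.
Hypothesis reward_cont :
  {within [set s : 'rV[R]_S * 'rV[R]_d | prob_vec s.1],
    continuous (reward mdl)}.
Hypothesis rewardB : forall s, prob_vec s.1 -> `|reward mdl s| <= B.

Let D := B / (1 - delta).

(** A realization exists, so [xget] selects the value of an actual one, and the estimate holds for
    whichever it selects. *)
Lemma value_horizon N (pi : policy S d A) s k : (0 < N)%N -> prob_vecN N s.1 ->
  exists q : {ffun 'I_N -> 'I_S} -> R,
  [/\ forall x, 0 <= q x, \sum_x q x = 1,
      forall x, q x != 0 -> empirical R x = s.1 &
      `|value mdl delta N pi s -
        \sum_x q x * horizon_value mdl delta k pi x s.2| <= delta ^+ k * D].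
Proof.
move=> N0 sP; have [ps0] := exists_particle_system mdl pi N0 sP.
rewrite /value; case: xgetP => [v _ [ps ->]|/(_ (expected_reward delta ps0))].
  exact: expected_reward_horizon.
by move=> h; exfalso; apply: h; exists ps0.
Qed.

Lemma value_ub N (pi : policy S d A) s k b : (0 < N)%N -> prob_vecN N s.1 ->
  (forall x : {ffun 'I_N -> 'I_S}, empirical R x = s.1 ->
     horizon_value mdl delta k pi x s.2 <= b) ->
  value mdl delta N pi s <= b + delta ^+ k * D.
Proof.
move=> N0 sP Jb; have [q [q0 q1 qs]] := value_horizon pi k N0 sP.
rewrite ler_distl => /andP[_] /le_trans; apply.
rewrite lerD2r -[leRHS]mul1r -q1 mulr_suml; apply: ler_sum => x _.
have [->|/qs/Jb Jx] := eqVneq (q x) 0; first by rewrite !mul0r.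
by rewrite ler_wpM2l.
Qed.

Lemma value_lb N (pi : policy S d A) s k b : (0 < N)%N -> prob_vecN N s.1 ->
  (forall x : {ffun 'I_N -> 'I_S}, empirical R x = s.1 ->
     b <= horizon_value mdl delta k pi x s.2) ->
  b - delta ^+ k * D <= value mdl delta N pi s.
Proof.
move=> N0 sP Jb; have [q [q0 q1 qs]] := value_horizon pi k N0 sP.
rewrite ler_distl => /andP[+ _]; apply: le_trans.
rewrite lerD2r -[leLHS]mul1r -q1 mulr_suml; apply: ler_sum => x _.
have [->|/qs/Jb Jx] := eqVneq (q x) 0; first by rewrite !mul0r.
by rewrite ler_wpM2l.
Qed.

(** Concerns one fixed sequence of initial states, to be applied at almost every sample point. *)
Lemma opt_value_cvg (M : nat -> 'rV[R]_S) (C : nat -> 'rV[R]_d) m c :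
  (forall N, (0 < N)%N -> prob_vecN N (M N)) ->
  M N @[N --> \oo] --> m -> C N @[N --> \oo] --> c ->
  opt_value mdl delta N (M N, C N) @[N --> \oo] --> det_opt mdl delta (m, c).
Proof.
move=> MP Mm Cc.
have mP : prob_vec m by apply: prob_vec_lim Mm => N /MP[].
have at_MC (Q : nat -> 'rV[R]_S * 'rV[R]_d -> Prop) :
    (\forall N \near \oo & s \near (m, c), Q N s) ->
    \forall N \near \oo, Q N (M N, C N).
  move=> [[U V] /= [Uoo [[V1 V2] /= [V1m V2c] V12]] UVQ].
  near=> N; apply: (UVQ (N, (M N, C N))); split => /=; first by near: N.
  by apply: V12; split => /=; near: N; [exact: Mm|exact: Cc].
have D0 : 0 <= D.
  apply: le_trans
    (det_opt_bound delta_ge0 delta_lt1 A_nonempty rewardB (s := (m, c)) mP).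
  exact: normr_ge0.
apply/cvgrPdist_le => e e0.
(* Four quarters: truncation of the particle value, truncation in the finite-horizon estimate, the
   slack of that estimate and, for the lower bound, the near-optimality of [a]. *)
have e40 : 0 < e / 4 by rewrite divr_gt0.
have [k dkD] : exists k, delta ^+ k * D <= e / 4.
  have dD : delta ^+ k * D @[k --> \oo] --> 0 * D.
    by apply: cvgM; [apply: cvg_expr; rewrite ger0_norm|exact: cvg_cst].
  rewrite mul0r in dD; have /cvgr0_norm_le/(_ _ e40)[k _ kP] := dD.
  by exists k; apply: le_trans (ler_norm _) _; exact: kP (leqnn k).
have near_ub := at_MC _ (horizon_value_ub delta_ge0 delta_lt1 A_nonempty
  A_compact kern_cont dyn_cont reward_cont rewardB k (s0 := (m, c)) mP e40).
(* The sequence is chosen before [N], so a single open-loop policy gives the lower bound for all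
   large [N]. *)
have [a opt_a] : exists a, det_opt mdl delta (m, c) - e / 4 <
    det_value mdl delta a (m, c).
  have has_sup_values :
      has_sup [set det_value mdl delta a (m, c) | a in [set: nat -> A]].
    split; first by case: A_nonempty => a0 _; eexists; exists (fun=> a0).
    exists D => _ [a _ <-]; apply: le_trans (ler_norm _) _.
    exact: (det_value_bound delta_ge0 delta_lt1 rewardB).
  by have [_ [a _ <-] ?] := sup_adherent e40 has_sup_values; exists a.
have near_lb := at_MC _ (horizon_value_lb delta_ge0 delta_lt1
  kern_cont dyn_cont reward_cont rewardB k a (s0 := (m, c)) mP e40).
near=> N; have N0 : (0 < N)%N by near: N; exact: nbhs_infty_gt.
have Jub (pi : policy S d A) : forall x : {ffun 'I_N -> 'I_S},
    empirical R x = M N ->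
    horizon_value mdl delta k pi x (C N) <=
      det_opt mdl delta (m, c) + delta ^+ k * D + e / 4.
  by move: pi; near: N; exact: near_ub.
have Jlb : forall x : {ffun 'I_N -> 'I_S}, empirical R x = M N ->
    det_value mdl delta a (m, c) - delta ^+ k * D - e / 4 <=
      horizon_value mdl delta k (open_loop a) x (C N).
  by near: N; exact: near_lb.
have ub pi : value mdl delta N pi (M N, C N) <= det_opt mdl delta (m, c) + e.
  by apply: le_trans (value_ub (s := (M N, C N)) N0 (MP N N0) (Jub pi)) _; lra.
have lb : det_opt mdl delta (m, c) - e <=
    value mdl delta N (open_loop a) (M N, C N).
  by apply: le_trans (value_lb (s := (M N, C N)) N0 (MP N N0) Jlb); lra.
(* The uniform bound [ub] makes the set of values bounded above and the open-loop policy makes it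
   nonempty, so its [sup] is a genuine supremum. *)
rewrite ler_distlC; apply/andP; split.
  apply: le_trans lb _; apply: ub_le_sup.
    by exists (det_opt mdl delta (m, c) + e) => _ [pi _ <-].
  by exists (open_loop a) => //; exact: admissible_open_loop.
apply: ge_sup; last by move=> _ [pi _ <-].
by eexists; exists (open_loop a) => //; exact: admissible_open_loop.
Unshelve. all: by end_near. Qed.

End convergence.

Theorem theorem9 (R : realType) (S d : nat) (A : metricType R)
  (mdl : model S d A) (delta : R)
  (disp : measure_display) (Omega : measurableType disp)
  (P : probability Omega R)
  (M0 : nat -> Omega -> 'rV[R]_S) (C0 : nat -> Omega -> 'rV[R]_d)
  (m : 'rV[R]_S) (c : 'rV[R]_d)
  (S_gt0 : (0 < S)%N) (d_gt0 : (0 < d)%N)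
  (delta_ge0 : 0 <= delta) (delta_lt1 : delta < 1)
  (A_nonempty : [set: A] !=set0)
  (A_compact : compact [set: A])
  (kern_cont : continuous (fun p : 'rV[R]_d * A => kern mdl p.2 p.1))
  (kern_unif : forall c', unif_continuous (fun a : A => kern mdl a c'))
  (dyn_cont : {within [set p : 'rV[R]_d * 'rV[R]_S * A | prob_vec p.1.2],
                continuous (fun p => dyn mdl p.1.1 p.1.2 p.2)})
  (dyn_unif : forall c' m', prob_vec m' ->
                unif_continuous (fun a : A => dyn mdl c' m' a))
  (reward_cont : {within [set s : 'rV[R]_S * 'rV[R]_d | prob_vec s.1],
                   continuous (reward mdl)})
  (reward_bounded : exists B : R, forall s : 'rV[R]_S * 'rV[R]_d,
                      prob_vec s.1 -> `|reward mdl s| <= B)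
  (M0_rv : forall N, (0 < N)%N -> borel_rv (M0 N))
  (C0_rv : forall N, (0 < N)%N -> borel_rv (C0 N))
  (M0_state : forall N w, (0 < N)%N -> prob_vecN N (M0 N w))
  (init_cvg : {ae P, forall w, M0 N w @[N --> \oo] --> m /\
                               C0 N w @[N --> \oo] --> c})
  (C0_bounded : exists B : R,
     {ae P, forall w, forall N, (0 < N)%N -> forall i, `|C0 N w 0 i| <= B}) :
  {ae P, forall w,
     opt_value mdl delta N (M0 N w, C0 N w) @[N --> \oo]
       --> det_opt mdl delta (m, c)} /\
  (forall s : 'rV[R]_S * 'rV[R]_d, prob_vec s.1 ->
     det_opt mdl delta s =
     reward mdl s + delta * sup [set det_opt mdl delta (Phi mdl a s)
                                | a in [set: A]]).
Proof.
have [B rewardB] := reward_bounded.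
split; last exact: det_opt_bellman delta_ge0 delta_lt1 A_nonempty rewardB.
apply: filterS init_cvg => w [Mm Cc].
apply: (opt_value_cvg delta_ge0 delta_lt1 A_nonempty A_compact kern_cont
  dyn_cont reward_cont rewardB) Mm Cc => N N0.
exact: M0_state.
Qed.
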